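(* Let $R$ be a commutative ring with identity such that $2=2\cdot 1_R\in U(R)$ and $-1$ is a perfect square in $R$. If there exist linear codes $C_1,C_2$ of length $m$ over $R$, with respective minimum distances $d_1,d_2$, such that $C_1=C_2^\perp$ and $C_2=C_1^\perp$, then there exists a self-dual matrix-product code of length $2m$ over $R$ with minimum distance $d$ satisfying $d\ge\min\{2d_1,d_2\}$.
   Context: $U(R)$ is the group of units of $R$; ''$-1$ is a perfect square'' means there is $u\in R$ with $u^2=-1$. A linear code of length $m$ over $R$ is an $R$-submodule of $R^m$. With $\langle x,y\rangle=\sum_{k} x_ky_k$, the dual of $C\subseteq R^m$ is $C^\perp=\{x\in R^m : \langle x,c\rangle=0 \text{ for all } c\in C\}$; $C$ is self-dual if $C=C^\perp$. The minimum distance of a (nonzero) linear code is the minimum Hamming weight (number of nonzero coordinates) of its nonzero elements; codes for which a minimum distance is mentioned are understood to be nonzero. For linear codes $D_1,\dots,D_s$ of length $n$ over $R$ and an $s\times l$ matrix $A=(a_{i,j})$ over $R$ ($s\le l$), the matrix-product code $[D_1\,\dots\,D_s]\,A$ is the linear code of length $nl$ consisting of all $\left(\sum_{i=1}^s a_{i,1}c_i,\dots,\sum_{i=1}^s a_{i,l}c_i\right)$ with $c_i\in D_i$. *)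

(* Defs.v *)
From mathcomp Require Import all_boot all_algebra.
From mathcomp Require Import boolp classical_sets.

Set Implicit Arguments.
Unset Strict Implicit.
Unset Printing Implicit Defensive.

Import GRing.Theory.
Local Open Scope ring_scope.
Local Open Scope classical_set_scope.

Definition linear_code (R : comPzRingType) (m : nat) (C : set 'rV[R]_m) : Prop :=
  submod_closed [in C].

Definition dotp (R : comPzRingType) (m : nat) (x y : 'rV[R]_m) : R :=
  \sum_(k < m) x 0 k * y 0 k.

Definition dual (R : comPzRingType) (m : nat) (C : set 'rV[R]_m) :
    set 'rV[R]_m :=
  [set x | forall c, C c -> dotp x c = 0].

Definition self_dual (R : comPzRingType) (m : nat) (C : set 'rV[R]_m) : Prop :=
  C = dual C.

Definition hamming_weight (R : comPzRingType) (m : nat) (x : 'rV[R]_m) : nat :=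
  #|[pred k | x 0 k != 0]|.

(* A relation rather than a function: it holds for no [d] when [C] has no
   nonzero codeword. *)
Definition min_distance (R : comPzRingType) (m : nat) (C : set 'rV[R]_m)
    (d : nat) : Prop :=
  (exists c, [/\ C c, c != 0 & hamming_weight c = d]) /\
  (forall c, C c -> c != 0 -> (d <= hamming_weight c)%N).

(* The [l] blocks, each of length [n], are the rows of an [l] x [n] matrix;
   [mxvec] concatenates these rows. *)
Definition matrix_product_code (R : comPzRingType) (n s l : nat)
    (D : s.-tuple (set 'rV[R]_n)) (A : 'M[R]_(s, l)) : set 'rV[R]_(l * n) :=
  [set w | exists c : 'I_s -> 'rV[R]_n,
     (forall i, tnth D i (c i)) /\
     w = mxvec (\matrix_(j < l) (\sum_(i < s) A i j *: c i))].

(* Main.v *)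
(* With u ^+ 2 = -1 the vectors (1, u) and (1, -u) are isotropic and their
   product is 2.  Taking them as the rows of A, the codewords are
   w = (x + y, u (x - y)) with x in C1 and y in C2, and <w, w'> is
   2 (<x, y'> + <y, x'>); as 2 is a unit, every w has this form for some x and
   y, so w is orthogonal to the code iff x is in the dual of C2 and y is in the
   dual of C1.
   If y = 0 then w = (x, u x) has twice the weight of x; otherwise the support
   of y is covered by those of x + y and x - y. *)
Require Import Defs.
From mathcomp Require Import all_boot all_algebra.
From mathcomp Require Import boolp classical_sets.
From mathcomp Require Import ring.

Set Implicit Arguments.
Unset Strict Implicit.
Unset Printing Implicit Defensive.

Import GRing.Theory.
Local Open Scope ring_scope.
Local Open Scope classical_set_scope.

Section InnerProduct.
Variables (R : comPzRingType) (m : nat).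
Implicit Types (a : R) (x y z : 'rV[R]_m).

Lemma dotpC x y : dotp x y = dotp y x.
Proof. by apply: eq_bigr => k _; rewrite mulrC. Qed.

Lemma dotpDl x y z : dotp (x + y) z = dotp x z + dotp y z.
Proof. by rewrite -big_split; apply: eq_bigr => k _; rewrite mxE mulrDl. Qed.

Lemma dotpZl a x z : dotp (a *: x) z = a * dotp x z.
Proof. by rewrite /dotp big_distrr; apply: eq_bigr => k _; rewrite mxE -mulrA. Qed.

Lemma dotpDr x y z : dotp z (x + y) = dotp z x + dotp z y.
Proof. by rewrite !(dotpC z) dotpDl. Qed.

Lemma dotpZr a x z : dotp z (a *: x) = a * dotp z x.
Proof. by rewrite !(dotpC z) dotpZl. Qed.

Lemma dotp0r x : dotp x 0 = 0.
Proof. by rewrite -(scale0r 0) dotpZr mul0r. Qed.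

Lemma dotp_mxvec l (M N : 'M[R]_(l, m)) :
  dotp (mxvec M) (mxvec N) = \sum_(j < l) dotp (row j M) (row j N).
Proof.
rewrite /dotp (reindex _ (curry_mxvec_bij l m)) /= pair_big /=.
by apply: eq_bigr => -[i j] _ /=; rewrite !mxvecE !mxE.
Qed.

End InnerProduct.

Section HammingWeight.
Variables (R : comPzRingType) (m : nat).
Implicit Types (x y z : 'rV[R]_m).

Lemma hamming_weight_mxvec l (M : 'M[R]_(l, m)) :
  hamming_weight (mxvec M) = (\sum_(j < l) hamming_weight (row j M))%N.
Proof.
(* A sum of 0/1 indicators over all coordinates can be reindexed by pairs (block, position), unlike
   a cardinality. *)
have hwE n (v : 'rV[R]_n) : hamming_weight v = (\sum_(k < n) (v 0%R k != 0%R))%N.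
  by rewrite /hamming_weight -sum1_card -big_mkcond.
rewrite hwE (reindex _ (curry_mxvec_bij l m)) /=.
under [RHS]eq_bigr do rewrite hwE.
rewrite pair_big /=.
by apply: eq_bigr => -[i j] _ /=; rewrite mxvecE !mxE.
Qed.

Lemma leq_hamming_weight x y :
  (forall k, y 0 k = 0 -> x 0 k = 0) -> (hamming_weight x <= hamming_weight y)%N.
Proof.
move=> yx; apply/subset_leq_card/fintype.subsetP => k; rewrite !inE.
by apply: contra_neq => /yx.
Qed.

(** The support of [x] lies in the union of the supports of [y] and [z], whose size is at most the
    sum of theirs. *)
Lemma leq_hamming_weightD x y z :
  (forall k, y 0 k = 0 -> z 0 k = 0 -> x 0 k = 0) ->
  (hamming_weight x <= hamming_weight y + hamming_weight z)%N.
Proof.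
move=> yzx; rewrite /hamming_weight -cardUI; apply: leq_trans (leq_addr _ _).
apply/subset_leq_card/fintype.subsetP => k; rewrite !inE.
by apply: contra_neqT; rewrite negb_or !negbK => /andP[/eqP + /eqP]; apply: yzx.
Qed.

(** The weights of nonzero codewords form a nonempty set of naturals, so a least one exists and is
    attained. *)
Lemma min_distance_exists (C : set 'rV[R]_m) :
  (exists2 c, C c & c != 0) -> exists d, min_distance C d.
Proof.
case=> c Cc c0.
pose P d := `[< exists c, [/\ C c, c != 0 & hamming_weight c = d] >].
have exP : exists d, P d by exists (hamming_weight c); apply/asboolP; exists c.
case: (ex_minnP exP) => d /asboolP Pd dmin.
exists d; split=> // b Cb b0; apply: dmin; apply/asboolP; by exists b.
Qed.

End HammingWeight.

Section TwoBlocks.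
Variables (R : comPzRingType) (m : nat) (u : R).
Implicit Types (x y : 'rV[R]_m).

Definition isotropic_mx : 'M[R]_2 :=
  \matrix_(i, j) if j == 0 then 1 else if i == 0 then u else - u.

Definition two_block x y : 'rV[R]_(2 * m) :=
  mxvec (\matrix_(j < 2) (if j == 0 then x + y else u *: (x - y))).

Lemma matrix_product_isotropic (C1 C2 : set 'rV[R]_m) w :
  matrix_product_code [tuple C1; C2] isotropic_mx w <->
  exists x y, [/\ C1 x, C2 y & w = two_block x y].
Proof.
split=> [[c [Cc ->]]|[x [y [Cx Cy ->]]]].
  exists (c 0), (c 1); split; [exact: (Cc 0)|exact: (Cc 1)|].
  congr mxvec; apply/row_matrixP => j; rewrite !rowK !big_ord_recl big_ord0 !mxE.
  have -> : lift ord0 ord0 = 1 :> 'I_2 by apply: val_inj.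
  by rewrite addr0; case: (j == 0); rewrite ?scale1r // scaleNr scalerBr.
exists (fun i => if i == 0 then x else y); split.
  by case=> -[|[|//]] lt_i.
congr mxvec; apply/row_matrixP => j; rewrite !rowK !big_ord_recl big_ord0 !mxE.
by rewrite /= addr0; case: (j == 0); rewrite ?scale1r // scaleNr scalerBr.
Qed.

Lemma hamming_weight_two_block x y :
  hamming_weight (two_block x y) =
  (hamming_weight (x + y) + hamming_weight (u *: (x - y)))%N.
Proof. by rewrite hamming_weight_mxvec !big_ord_recl big_ord0 !rowK addn0. Qed.

Hypothesis u2 : u ^+ 2 = -1.

(** [R] may have zero divisors, but [u] is a unit with inverse [- u]. *)
Lemma sqrtN1_regular (a : R) : u * a = 0 -> a = 0.
Proof.
move=> ua0; suff: - (u * (u * a)) = a by rewrite ua0 mulr0 oppr0.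
by rewrite mulrA -expr2 u2 mulN1r opprK.
Qed.

(** The second block contributes [u ^+ 2 = -1] times the product of the differences: the terms in
    [x, x'] and [y, y'] cancel and the mixed ones double. *)
Lemma dotp_two_block x y x' y' :
  dotp (two_block x y) (two_block x' y') = 2%:R * (dotp x y' + dotp y x').
Proof.
rewrite dotp_mxvec !big_ord_recl big_ord0 !rowK /= addr0.
rewrite -!scaleN1r !(dotpDl, dotpDr, dotpZl, dotpZr).
ring: u2.
Qed.

Variable v : R.
Hypothesis v2 : v * 2%:R = 1.

Lemma two_regular (a : R) : 2%:R * a = 0 -> a = 0.
Proof. by move=> a0; rewrite -(mul1r a) -v2 -mulrA a0 mulr0. Qed.

Lemma two_block_surj (w : 'rV[R]_(2 * m)) : exists x y, w = two_block x y.
Proof.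
pose M : 'M[R]_(2, m) := vec_mx w; pose p := row ord0 M; pose q := row ord_max M.
(* Solves [p = x + y], [q = u *: (x - y)]: the second equation gives [x - y = - u *: q], and [v]
   halves the sum and the difference. *)
exists (v *: (p - u *: q)), (v *: (p + u *: q)).
rewrite /two_block -[LHS]vec_mxK; congr mxvec; apply/row_matrixP => j; rewrite rowK.
have v2p t : v *: t + v *: t = t.
  by rewrite -scalerDl -[v + v]mulr2n -mulr_natr v2 scale1r.
case: j => -[|[|//]] lt_j /=.
  rewrite -scalerDr addrACA addNr addr0 scalerDr v2p.
  by congr row; apply: val_inj.
rewrite -scalerBr opprD addrACA subrr add0r -opprD scalerN scalerN.
rewrite scalerDr v2p scalerA -expr2 u2 scaleN1r opprK.
by congr row; apply: val_inj.
Qed.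

Lemma leq_two_block_l x : (2 * hamming_weight x <= hamming_weight (two_block x 0%R))%N.
Proof.
rewrite hamming_weight_two_block addr0 subr0 mul2n -addnn leq_add2l.
by apply: leq_hamming_weight => k; rewrite mxE => /sqrtN1_regular.
Qed.

(** Where both blocks vanish, so do [x + y] and [x - y], hence also their difference, twice [y]. *)
Lemma leq_two_block_r x y : (hamming_weight y <= hamming_weight (two_block x y))%N.
Proof.
rewrite hamming_weight_two_block; apply: leq_hamming_weightD => k.
rewrite !mxE => xy0 /sqrtN1_regular xy1; apply: two_regular.
have -> : 2%:R * y 0 k = (x 0 k + y 0 k) - (x 0 k - y 0 k) by ring.
by rewrite xy0 xy1 subrr.
Qed.

End TwoBlocks.

Theorem corollary4p6 (R : comPzRingType)
    (two_unit : exists v : R, v * 2%:R = 1)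
    (neg1_square : exists u : R, u ^+ 2 = -1)
    (m : nat) (C1 C2 : set 'rV[R]_m) (d1 d2 : nat)
    (linC1 : linear_code C1) (linC2 : linear_code C2)
    (distC1 : min_distance C1 d1) (distC2 : min_distance C2 d2)
    (dualC1 : C1 = dual C2) (dualC2 : C2 = dual C1) :
  exists A : 'M[R]_2,
    self_dual (matrix_product_code [tuple C1; C2] A) /\
    exists d : nat,
      min_distance (matrix_product_code [tuple C1; C2] A) d /\
      (minn (2 * d1) d2 <= d)%N.
Proof.
case: two_unit => v v2; case: neg1_square => u u2.
have C1_0 : C1 0 by case: linC1; rewrite unfold_in in_setE.
have C2_0 : C2 0 by case: linC2; rewrite unfold_in in_setE.
have C12 x y : C1 x -> C2 y -> dotp x y = 0 by rewrite {1}dualC1 => + Cy; apply.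
exists (isotropic_mx u); split.
  apply/seteqP; split=> w.
    move=> /matrix_product_isotropic[x [y [Cx Cy ->]]].
    move=> _ /matrix_product_isotropic[x' [y' [Cx' Cy' ->]]].
    by rewrite dotp_two_block // C12 // dotpC C12 // addr0 mulr0.
  have [x [y ->]] := two_block_surj u2 v2 w => xy_dual.
  apply/matrix_product_isotropic; exists x, y; split=> //.
    rewrite dualC1 => y' Cy'; apply: (two_regular v2).
    (* Pairing with the codeword built from [0] and [y'] leaves only twice [dotp x y']. *)
    have := xy_dual (two_block u 0 y').
    rewrite dotp_two_block // dotp0r addr0; apply.
    by apply/matrix_product_isotropic; exists 0, y'.
  rewrite dualC2 => x' Cx'; apply: (two_regular v2).
  have := xy_dual (two_block u x' 0).
  rewrite dotp_two_block // dotp0r add0r; apply.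
  by apply/matrix_product_isotropic; exists x', 0.
have hw0 n : hamming_weight (0 : 'rV[R]_n) = 0%N.
  by apply: eq_card0 => k; rewrite !inE mxE eqxx.
have hw_neq0 n (c : 'rV[R]_n) : (0 < hamming_weight c)%N = (c != 0).
  apply/idP/idP => [|/eqP c0]; first by apply: contraTneq => ->; rewrite hw0.
  rewrite lt0n; apply: contra_notN c0 => /eqP/card0_eq c0.
  by apply/rowP => k; have := c0 k; rewrite !inE mxE => /negbFE/eqP.
have [d dP] : exists d,
    min_distance (matrix_product_code [tuple C1; C2] (isotropic_mx u)) d.
  (* A nonzero [y] in [C2] yields the codeword [two_block u 0 y], nonzero because its weight is at
     least that of [y]. *)
  apply: min_distance_exists; have [[y [Cy y0 _]] _] := distC2.
  exists (two_block u 0 y); first by apply/matrix_product_isotropic; exists 0, y.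
  by rewrite -hw_neq0 (leq_trans _ (leq_two_block_r u2 v2 0 y)) // hw_neq0.
exists d; split=> //.
(* The minimum [d] is attained at some nonzero [w], so it suffices to bound the weight of this
   word. *)
have [[w [/matrix_product_isotropic[x [y [Cx Cy ->]]] w0 <-]] _] := dP.
rewrite geq_min; have [y0|y0] := eqVneq y 0; last first.
  by rewrite (leq_trans (distC2.2 _ Cy y0) (leq_two_block_r u2 v2 x y)) orbT.
move: w0; rewrite y0 => w0.
(* With both [x] and [y] zero, [w] would have weight 0. *)
have x0 : x != 0.
  apply: contra_neq w0 => ->; apply/eqP; rewrite -[_ == _]negbK -hw_neq0.
  by rewrite hamming_weight_two_block addr0 subr0 scaler0 !hw0.
apply/orP; left; apply: leq_trans (leq_two_block_l u2 x).
by rewrite leq_mul2l (distC1.2 _ Cx x0).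
Qed.
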